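(* Let $V_{\mathrm{eig}}:=\operatorname{span}\{\phi_1,\dots,\phi_N\}$ be the span of the first $N$ eigenfunctions of $\mathcal{L}^{-1}$, and for $i\ge 1$ let $P_i$ be the spectral projector associated with the eigenvalues $\lambda_1,\lambda_2,\dots,\lambda_i$. Let $u_1^0,\dots,u_N^0\in V$ be the initial functions and let $\{U_H^n\}_{n\ge 0}$ be the sequence of spaces generated from them by iterative orthogonal decomposition. Assume that $\operatorname{rank}\big(P_i[u_1^0,u_2^0,\dots,u_i^0]\big)=i$ for $i=1,2,\dots,N$ (i.e. $P_iu_1^0,\dots,P_iu_i^0$ are linearly independent), and that $\lambda_N>\lambda_{N+1}$. Then the sequence of spaces $\{U_H^n\}$ converges to $V_{\mathrm{eig}}$ as $n\to\infty$.
   Context: Setting. $\Omega\subset\mathbb{R}^d$ is a polyhedral Lipschitz domain; $V$ is a Sobolev space on $\Omega$ (incorporating homogeneous Dirichlet boundary conditions) that is compactly embedded in $L^2(\Omega)$. $\mathcal{L}$ is a linear partial differential operator which is self-adjoint and positive definite, with associated bounded Hermitian sesquilinear form $a(\cdot,\cdot)$ on $V$ (so $a(u,v)=(\mathcal{L}u,v)_{L^2(\Omega)}$ and $a(v,v)>0$ for $v\ne0$). The problem $\mathcal{L}u=f$ is well-posed: for every $f\in L^2(\Omega)$ there is a unique $u=:\mathcal{L}^{-1}f\in V$ with $a(u,v)=(f,v)_{L^2(\Omega)}$ for all $v\in V$, and $\mathcal{L}^{-1}:L^2(\Omega)\to V$ is bounded. Hence $\mathcal{L}^{-1}$ is a compact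 self-adjoint operator on $L^2(\Omega)$. Sesquilinear forms and inner products are linear in the first and conjugate-linear in the second argument. Eigenpairs. $\{(\lambda_i,\phi_i)\}_{i\ge1}$ are the eigenpairs of $\mathcal{L}^{-1}$ in $V$, counted with multiplicity, with $\lambda_1\ge\lambda_2\ge\cdots\ge0$ and the $\phi_i\in V$ mutually orthogonal, forming a complete orthogonal system of $V$. The spectral projector $P_i$ is the orthogonal projector onto $\operatorname{span}\{\phi_1,\dots,\phi_i\}$. Iterative orthogonal decomposition. Let $J=\{1,\dots,N\}$ and let $u_1^0,\dots,u_N^0\in V$ be linearly independent; $U_H^0:=\operatorname{span}\{u_j^0: j\in J\}$. For $n=0,1,2,\dots$ set $q_j^n:=(u_j^n,\cdot)_{L^2(\Omega)}$ and $W^n:=\{v\in V: q_j^n(v)=0\ \text{for all } j\in J\}$; let $\mathcal{C}^n:V\to W^n$ be the projection defined by $a(\mathcal{C}^nv,w)=a(v,w)$ for all $v\in V$, $w\in W^n$; and set $U_H^{n+1}:=(1-\mathcal{C}^n)V$. A basis $\{u_k^{n+1}\}_{k\in J}$ of $U_H^{n+1}$ is given by: for each $k\in J$, $u_k^{n+1}\in V$ and $\mu^{n+1}\in\mathbb{C}^N$ (depending on $k$) solve $a(u_k^{n+1},v)+\sum_{j\in J}\mu_j^{n+1}q_j^n(v)=0$ for all $v\in V$, and $q_j^n(u_k^{n+1})=\delta_{jk}$ for all $j\in J$. Convergence of spaces. $N$-dimensional subspaces $U_H^n$ converge to the $N$-dimensional subspace $V_{\mathrm{eig}}$ if there are functions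 $\hat u_1^n,\dots,\hat u_N^n$ with $U_H^n=\operatorname{span}\{\hat u_j^n\}_{j\in J}$ such that each limit $\lim_{n\to\infty}\hat u_j^n$ exists in $L^2(\Omega)$ and $\operatorname{span}\{\lim_{n\to\infty}\hat u_j^n: j\in J\}=V_{\mathrm{eig}}$. *)

(* Defs.v *)
From HB Require Import structures.
From mathcomp Require Import all_boot all_order all_algebra.
From mathcomp Require Import complex.
From mathcomp Require Import all_classical all_reals all_analysis.

Set Implicit Arguments.
Unset Strict Implicit.
Unset Printing Implicit Defensive.

Import Order.TTheory GRing.Theory Num.Theory.
Import numFieldNormedType.Exports.

Local Open Scope classical_set_scope.
Local Open Scope complex_scope.
Local Open Scope ring_scope.

Definition rV_display : measure_display.
Proof. exact: default_measure_display. Qed.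

(* 'rV[R]_n carries the product sigma-algebra, generated by the coordinates. *)
Section rV_measurable.
Variables (R : realType) (n : nat).

Let coord (i : 'I_n) (x : 'rV[R]_n) : measurableTypeR R := x 0 i.

Let rV_set0 : g_sigma_preimage coord set0.
Proof. exact: sigma_algebra0. Qed.

Let rV_setC A : g_sigma_preimage coord A -> g_sigma_preimage coord (~` A).
Proof. exact: sigma_algebraC. Qed.

Let rV_bigcup (F : _^nat) : (forall i, g_sigma_preimage coord (F i)) ->
  g_sigma_preimage coord (\bigcup_i (F i)).
Proof. exact: sigma_algebra_bigcup. Qed.

HB.instance Definition _ := @isMeasurable.Build rV_display
  'rV[R]_n (g_sigma_preimage coord) rV_set0 rV_setC rV_bigcup.

Lemma measurable_rV_coord (i : 'I_n) :
  measurable_fun [set: 'rV[R]_n] (fun x : 'rV[R]_n => x 0 i : measurableTypeR R).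
Proof.
move=> _ Y mY; rewrite setTI; apply: sub_sigma_algebra => /=.
rewrite -bigcup_seq/=; exists i => /=; first by rewrite mem_index_enum.
by exists Y => //; rewrite setTI.
Qed.

End rV_measurable.

Lemma measurable_rVP (R : realType) n d (T : measurableType d)
    (f : T -> 'rV[R]_n) :
  (forall i, measurable_fun [set: T] (fun t => f t 0 i : measurableTypeR R)) ->
  measurable_fun [set: T] f.
Proof.
move=> mf _ A mA.
have : g_sigma_preimage (fun i t => f t 0 i : measurableTypeR R) `<=` measurable.
  apply: smallest_sub; first exact: sigma_algebra_measurable.
  case: n f mf {A mA} => [|m] f mf; first by rewrite big_ord0.
  rewrite -bigcup_mkord_ord; apply: bigcup_sub => i Ii.
  by move=> B [C mC <-]; exact: mf.
rewrite (g_sigma_preimage_comp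
  (fun i (x : 'rV[R]_n) => x 0 i : measurableTypeR R) f) => sub.
by apply: sub; exists A.
Qed.

Section lebesgue_rV.
Variable R : realType.

Definition rV_cons n (p : measurableTypeR R * 'rV[R]_n) : 'rV[R]_n.+1 :=
  \row_i (if unlift ord0 i is Some j then p.2 0 j else p.1).

Definition rV_uncons n (x : 'rV[R]_n.+1) : measurableTypeR R * 'rV[R]_n :=
  (x 0 ord0, \row_j x 0 (lift ord0 j)).

Lemma rV_consK n : cancel (@rV_cons n) (@rV_uncons n).
Proof.
move=> [a v]; congr pair; rewrite /= ?mxE ?unlift_none//.
by apply/rowP => j; rewrite !mxE liftK.
Qed.

Lemma measurable_rV_cons n : measurable_fun setT (@rV_cons n).
Proof.
apply: measurable_rVP => i; rewrite /rV_cons.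
have [j|] := unliftP ord0 i => ->.
  rewrite (_ : (fun _ => _) = (fun x : 'rV[R]_n => x 0 j : measurableTypeR R) \o snd).
    by apply: measurableT_comp => //; exact: measurable_rV_coord.
  by apply/funext => p /=; rewrite mxE liftK.
rewrite (_ : (fun _ => _) = fst)//.
by apply/funext => p /=; rewrite mxE unlift_none.
Qed.

Lemma measurable_rV_uncons n : measurable_fun setT (@rV_uncons n).
Proof.
apply/measurable_fun_pairP; split; first exact: measurable_rV_coord.
apply: measurable_rVP => j.
rewrite (_ : (fun _ => _) =
    (fun x : 'rV[R]_n.+1 => x 0 (lift ord0 j) : measurableTypeR R)).
  exact: measurable_rV_coord.
by apply/funext => x /=; rewrite mxE.
Qed.

Section step.
Variables (n : nat) (mu : {sigma_finite_measure set 'rV[R]_n -> \bar R}).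

Definition lebesgue_rV_step : set 'rV[R]_n.+1 -> \bar R :=
  pushforward (lebesgue_measure \x mu)%E (@rV_cons n).

Let mstep : {measure set 'rV[R]_n.+1 -> \bar R} :=
  measure_function_pushforward__canonical__measure_function_Measure
    (lebesgue_measure \x mu)%E (@measurable_rV_cons n).

Let step0 : lebesgue_rV_step set0 = 0%E.
Proof. exact: (measure0 mstep). Qed.

Let step_ge0 A : (0 <= lebesgue_rV_step A)%E.
Proof. exact: (measure_ge0 mstep). Qed.

Let step_sigma_additive : semi_sigma_additive lebesgue_rV_step.
Proof. exact: (@measure_semi_sigma_additive _ _ _ mstep). Qed.

HB.instance Definition _ := isMeasure.Build _ _ _ lebesgue_rV_step
  step0 step_ge0 step_sigma_additive.

Let step_sigma_finite : sigma_finite setT lebesgue_rV_step.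
Proof.
have /sigma_finiteP[F [TF ndF Foo]] := sigma_finiteT (@lebesgue_measure R).
have /sigma_finiteP[G [TG ndG Goo]] := sigma_finiteT mu.
exists (fun k => @rV_uncons n @^-1` (F k `*` G k)).
  rewrite -preimage_bigcup -(preimage_setT (@rV_uncons n)); congr (_ @^-1` _).
  rewrite -setXTT TF TG; apply/seteqP; split => -[x y].
    move=> [/= [i _ Fx] [k _ Gy]]; exists (maxn i k) => //; split.
      by move: x Fx; exact/subsetPset/ndF/leq_maxl.
    by move: y Gy; exact/subsetPset/ndG/leq_maxr.
  by move=> [k _ []/= ? ?]; split; exists k.
move=> k; have [mF Fk] := Foo k; have [mG Gk] := Goo k; split.
  rewrite -[X in measurable X]setTI; apply: measurable_rV_uncons => //.
  exact: measurableX.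
rewrite /lebesgue_rV_step /pushforward (_ : _ @^-1` _ = F k `*` G k).
  by rewrite product_measure1E// lte_mul_pinfty// ge0_fin_numE.
rewrite -comp_preimage (_ : _ \o _ = id) ?preimage_id//.
by apply/funext => p; exact: rV_consK.
Qed.

HB.instance Definition _ := Measure_isSigmaFinite.Build _ _ _
  lebesgue_rV_step step_sigma_finite.

End step.

(* n-dimensional Lebesgue measure, as the n-fold product of lebesgue_measure *)
Fixpoint lebesgue_rV n : {sigma_finite_measure set 'rV[R]_n -> \bar R} :=
  if n is m.+1 then [the {sigma_finite_measure set 'rV[R]_m.+1 -> \bar R}
                      of lebesgue_rV_step (lebesgue_rV m)]
  else [the {sigma_finite_measure set 'rV[R]_0 -> \bar R} of \d_(0 : 'rV[R]_0)].

End lebesgue_rV.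

Section function_spaces.
Variables (R : realType) (d : nat).
Local Notation mu := (lebesgue_rV R d).
Local Notation fn := ('rV[R]_d -> R[i]).

Definition dotv (x y : 'rV[R]_d) : R := \sum_i x 0 i * y 0 i.

(* Near each boundary point Om is a strict epigraph, in the direction of a unit
   vector e, of a Lipschitz function of the variables orthogonal to e; such a
   function is represented by gam on R^d that does not vary along e. *)
Definition lipschitz_boundary (Om : set 'rV[R]_d) : Prop :=
  forall x, (closure Om `\` Om) x ->
    exists (r k : R) (e : 'rV[R]_d) (gam : 'rV[R]_d -> R),
      [/\ 0 < r, dotv e e = 1,
          forall y z, `|gam y - gam z| <= k * `|y - z|,
          forall y t, gam (y + t *: e) = gam y
        & forall y, ball x r y -> (Om y <-> gam y < dotv y e)].

Definition polyhedral_boundary (Om : set 'rV[R]_d) : Prop :=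
  exists (k : nat) (nu : 'I_k -> 'rV[R]_d) (b : 'I_k -> R),
    (forall i, nu i != 0) /\
    forall x, (closure Om `\` Om) x -> exists i, dotv (nu i) x = b i.

Record polyhedral_lipschitz_domain (Om : set 'rV[R]_d) : Prop := {
  domain_open : open Om;
  domain_connected : connected Om;
  domain_nonempty : Om !=set0;
  domain_bounded : bounded_set Om;
  domain_lipschitz : lipschitz_boundary Om;
  domain_polyhedral : polyhedral_boundary Om }.

Variable Om : set 'rV[R]_d.

(* Elements of L^2(Om) are represented by functions on R^d, of which only the
   values on Om matter; equality in L^2(Om) is aeq. *)
Definition aeq (f g : fn) : Prop := {ae mu, forall x, Om x -> f x = g x}.

Definition L2 : set fn := [set f : fn |
  [/\ measurable_fun Om (fun x => complex.Re (f x) : measurableTypeR R),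
      measurable_fun Om (fun x => complex.Im (f x) : measurableTypeR R)
    & mu.-integrable Om
        (fun x => (complex.Re (f x) ^+ 2 + complex.Im (f x) ^+ 2)%:E)]].

Definition L2dot (f g : fn) : R[i] :=
  (\int[mu]_(x in Om) complex.Re (f x * (g x)^*)) +i*
  (\int[mu]_(x in Om) complex.Im (f x * (g x)^*)).

Definition L2norm (f : fn) : R := Num.sqrt (complex.Re (L2dot f f)).

Definition L2span k (w : 'I_k -> fn) : set fn :=
  [set f : fn | L2 f /\ exists c : 'I_k -> R[i], aeq f (\sum_j c j *: w j)].

Definition lin_indep k (w : 'I_k -> fn) : Prop :=
  forall c : 'I_k -> R[i], aeq (\sum_j c j *: w j) 0 -> forall j, c j = 0.

Definition orth_projector (S : set fn) (P : fn -> fn) : Prop :=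
  forall f, L2 f -> S (P f) /\ forall w, S w -> L2dot (f - P f) w = 0.

Definition pderiv (i : 'I_d) (f : 'rV[R]_d -> R) : 'rV[R]_d -> R :=
  'D_(delta_mx 0 i) f.

Definition mderiv (al : 'I_d -> nat) (f : 'rV[R]_d -> R) : 'rV[R]_d -> R :=
  foldr (fun i => iter (al i) (pderiv i)) f (enum 'I_d).

(* Smoothness: all iterated partial derivatives are differentiable. *)
Definition test_function (f : 'rV[R]_d -> R) : Prop :=
  (forall (s : seq 'I_d) x, differentiable (foldr pderiv f s) x) /\
  exists K, [/\ compact K, K `<=` Om & forall x, ~ K x -> f x = 0].

Definition mabs (al : 'I_d -> nat) : nat := (\sum_i al i)%N.

Definition weak_deriv (al : 'I_d -> nat) (f g : fn) : Prop :=
  L2 g /\ forall psi, test_function psi ->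
    L2dot g (fun x => (psi x)%:C) =
    (-1) ^+ mabs al * L2dot f (fun x => (mderiv al psi x)%:C).

(* Well defined up to aeq, since weak derivatives are unique. *)
Definition wderiv (al : 'I_d -> nat) (f : fn) : fn :=
  if mabs al == 0%N then f else xget 0 [set g : fn | weak_deriv al f g].

Definition sobolev (m : nat) : set fn := [set f : fn | L2 f /\
  forall al : 'I_d -> nat, (mabs al <= m)%N -> exists g, weak_deriv al f g].

Definition sobolev_norm (m : nat) (f : fn) : R :=
  Num.sqrt (\sum_(al : {ffun 'I_d -> 'I_m.+1} | (mabs (fun i => al i) <= m)%N)
              L2norm (wderiv (fun i => al i) f) ^+ 2).

(* A closed subspace V of H^m(Om) with H^m_0(Om) `<=` V: the choice of V encodes
   which homogeneous Dirichlet conditions are imposed, and where. *)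
Record sobolev_space (m : nat) (V : set fn) : Prop := {
  sobolev_space_sub : V `<=` sobolev m;
  sobolev_space_aeq : forall f g, V f -> L2 g -> aeq f g -> V g;
  sobolev_space_test : forall psi, test_function psi -> V (fun x => (psi x)%:C);
  sobolev_space_lin : forall (c : R[i]) f g, V f -> V g -> V (c *: f + g);
  sobolev_space_closed : forall (v : nat -> fn) f,
    (forall n, V (v n)) -> sobolev m f ->
    sobolev_norm m (v n - f) @[n --> \oo] --> (0 : R) -> V f }.

Definition compactly_embedded (m : nat) (V : set fn) : Prop :=
  forall v : nat -> fn, (forall n, V (v n)) ->
    (exists B : R, forall n, sobolev_norm m (v n) <= B) ->
    exists (s : nat -> nat) (f : fn),
      [/\ {homo s : i j / (i < j)%N}, L2 f
        & L2norm (v (s n) - f) @[n --> \oo] --> (0 : R)].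

Record bounded_hermitian_form (m : nat) (V : set fn) (a : fn -> fn -> R[i])
    : Prop := {
  form_aeq : forall f g v, V f -> V g -> V v -> aeq f g -> a f v = a g v;
  form_lin : forall (c : R[i]) f g v, V f -> V g -> V v ->
    a (c *: f + g) v = c * a f v + a g v;
  form_herm : forall f g, V f -> V g -> a f g = (a g f)^*;
  form_bounded : exists B : R, forall f g, V f -> V g ->
    `|a f g| <= (B * sobolev_norm m f * sobolev_norm m g)%:C }.

Definition positive_definite (V : set fn) (a : fn -> fn -> R[i]) : Prop :=
  forall v, V v -> ~ aeq v 0 -> 0 < a v v.

(* "u is in the domain of the operator L associated with a, and L u = f" *)
Definition operator_graph (V : set fn) (a : fn -> fn -> R[i]) (u f : fn)
  : Prop := V u /\ forall v, V v -> a u v = L2dot f v.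

(* Linv is the bounded solution operator L^-1 : L^2(Om) -> V. *)
Record well_posed (m : nat) (V : set fn) (a : fn -> fn -> R[i])
    (Linv : fn -> fn) : Prop := {
  well_posed_ex : forall f, L2 f -> operator_graph V a (Linv f) f;
  well_posed_uniq : forall f u, L2 f -> operator_graph V a u f ->
    aeq u (Linv f);
  well_posed_bounded : exists B : R, forall f, L2 f ->
    sobolev_norm m (Linv f) <= B * L2norm f }.

(* Indices start at 0: lam 0, phi 0 are the first eigenvalue and eigenfunction.
   Orthogonality is meant in L^2(Om); for eigenfunctions of L^-1 this is the
   same as orthogonality for a. *)
Record eigensystem (m : nat) (V : set fn) (Linv : fn -> fn)
    (lam : nat -> R) (phi : nat -> fn) : Prop := {
  eigen_in : forall i, V (phi i);
  eigen_neq0 : forall i, ~ aeq (phi i) 0;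
  eigen_eq : forall i, aeq (Linv (phi i)) ((lam i)%:C *: phi i);
  eigen_ge0 : forall i, 0 <= lam i;
  eigen_noninc : forall i j, (i <= j)%N -> lam j <= lam i;
  eigen_orth : forall i j, i != j -> L2dot (phi i) (phi j) = 0;
  eigen_complete : forall v, V v -> forall e : R, 0 < e ->
    exists (k : nat) (c : 'I_k -> R[i]),
      sobolev_norm m (v - \sum_(i < k) c i *: phi i) < e }.

Section iod.
Variables (V : set fn) (a : fn -> fn -> R[i]) (N : nat).
Variables (u : nat -> 'I_N -> fn) (C : nat -> fn -> fn).

Definition iod_q (n : nat) (j : 'I_N) (v : fn) : R[i] := L2dot (u n j) v.

Definition iod_W (n : nat) : set fn :=
  [set v : fn | V v /\ forall j, iod_q n j v = 0].

(* For n = n'.+1 this is (1 - C n') V, closed under aeq so that it can be compared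
   with an L2span. *)
Definition iod_space (n : nat) : set fn :=
  if n is n'.+1 then
    [set f : fn | L2 f /\ exists v, V v /\ aeq f (v - C n' v)]
  else L2span (u 0%N).

Record iod : Prop := {
  iod_init : forall j, V (u 0%N j);
  iod_init_indep : lin_indep (u 0%N);
  iod_proj : forall n v, V v -> iod_W n (C n v) /\
    forall w, iod_W n w -> a (C n v) w = a v w;
  iod_basis : forall n k, V (u n.+1 k) /\
    exists xi : 'I_N -> R[i],
      (forall v, V v -> a (u n.+1 k) v + \sum_j xi j * iod_q n j v = 0) /\
      forall j, iod_q n j (u n.+1 k) = (j == k)%:R }.

End iod.

(* The two lin_indep clauses say that the spaces U n and E have dimension N. *)
Definition spaces_cvg (N : nat) (U : nat -> set fn) (E : set fn) : Prop :=
  exists (uh : nat -> 'I_N -> fn) (l : 'I_N -> fn),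
    [/\ forall n, [/\ forall j, L2 (uh n j), lin_indep (uh n)
                    & U n = L2span (uh n)],
        forall j, L2 (l j) /\ L2norm (uh n j - l j) @[n --> \oo] --> (0 : R),
        lin_indep l
      & E = L2span l].

End function_spaces.

(* Main.v *)
(* Subspace iteration for the compact operator L^-1. Testing the saddle point
   problem shows U^(n+1) = L^-1 U^n. By the rank condition for i = N, the space
   U^0 has a basis v_1, ..., v_N with v_j - phi_j orthogonal to phi_1, ..., phi_N.
   On the orthogonal complement of phi_1, ..., phi_N in V the norm of L^-1 is at
   most lambda_(N+1), so lambda_j^(-n) L^(-n) v_j, a basis of U^n, converges to
   phi_j at the rate (lambda_(N+1) / lambda_j)^n. *)
Require Import Defs.
From mathcomp Require Import all_boot all_order all_algebra.
From mathcomp Require Import complex ring lra.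
From mathcomp Require Import all_classical all_reals all_analysis.
From mathcomp Require Import measurable_realfun.

Set Implicit Arguments.
Unset Strict Implicit.
Unset Printing Implicit Defensive.

Import Order.TTheory GRing.Theory Num.Theory.
Import numFieldNormedType.Exports.
Local Open Scope classical_set_scope.
Local Open Scope ring_scope.

(** * Sesquilinear Hermitian forms on a linear subdomain *)

Section hermitian_on.
Context {K : numClosedFieldType} {E : lmodType K}.

(** The domain [S] is explicit because the two forms in use, [L2dot] and [a], are functions on all
    of [fn] but are sesquilinear only on [L2] and on [V]. One theory then serves both. *)
Record hermitian_on (S : set E) (b : E -> E -> K) : Prop := {
  herm_dom0 : S 0;
  herm_domP : forall c f g, S f -> S g -> S (c *: f + g);
  herm_linear : forall c f g h, S f -> S g -> S h ->
    b (c *: f + g) h = c * b f h + b g h;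
  herm_sym : forall f g, S f -> S g -> b f g = (b g f)^* }.

Variables (S : set E) (b : E -> E -> K).
Hypothesis bS : hermitian_on S b.

Lemma herm_domD f g : S f -> S g -> S (f + g).
Proof. by move=> Sf Sg; rewrite -[f]scale1r; exact: (herm_domP bS). Qed.

Lemma herm_domZ c f : S f -> S (c *: f).
Proof.
by move=> Sf; rewrite -[_ *: _]addr0; apply: (herm_domP bS) => //; exact: herm_dom0 bS.
Qed.

Lemma herm_domB f g : S f -> S g -> S (f - g).
Proof. by move=> Sf Sg; rewrite addrC -scaleN1r; exact: (herm_domP bS). Qed.

Lemma herm_dom_sum I (r : seq I) (Q : pred I) (c : I -> K) (w : I -> E) :
  (forall i, S (w i)) -> S (\sum_(i <- r | Q i) c i *: w i).
Proof.
move=> Sw; elim/big_ind: _ => [|f g|i _]; [exact: herm_dom0 bS|exact: herm_domD|].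
exact: herm_domZ.
Qed.

Lemma herm_Dl f g h : S f -> S g -> S h -> b (f + g) h = b f h + b g h.
Proof. by move=> Sf Sg Sh; rewrite -{1}[f]scale1r (herm_linear bS)// mul1r. Qed.

Lemma herm_Bl f g h : S f -> S g -> S h -> b (f - g) h = b f h - b g h.
Proof. by move=> *; rewrite addrC -scaleN1r (herm_linear bS)// mulN1r addrC. Qed.

Lemma herm_0l h : S h -> b 0 h = 0.
Proof. by move=> Sh; rewrite -(subrr h) herm_Bl// subrr. Qed.

Lemma herm_Zl c f h : S f -> S h -> b (c *: f) h = c * b f h.
Proof.
move=> Sf Sh; rewrite -[_ *: _]addr0 (herm_linear bS) ?herm_0l ?addr0//.
exact: herm_dom0 bS.
Qed.

Lemma herm_suml I (r : seq I) (Q : pred I) (c : I -> K) (w : I -> E) h :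
  (forall i, S (w i)) -> S h ->
  b (\sum_(i <- r | Q i) c i *: w i) h = \sum_(i <- r | Q i) c i * b (w i) h.
Proof.
move=> Sw Sh; elim: r => [|i r IHr]; first by rewrite !big_nil herm_0l.
rewrite !big_cons; case: ifP => // _.
by rewrite (herm_linear bS) ?IHr//; exact: herm_dom_sum.
Qed.

Lemma herm_Dr f g h : S f -> S g -> S h -> b h (f + g) = b h f + b h g.
Proof.
move=> Sf Sg Sh; rewrite (herm_sym bS)//; last exact: herm_domD.
by rewrite herm_Dl// rmorphD/= -!(herm_sym bS).
Qed.

Lemma herm_Br f g h : S f -> S g -> S h -> b h (f - g) = b h f - b h g.
Proof.
move=> Sf Sg Sh; rewrite (herm_sym bS)//; last exact: herm_domB.
by rewrite herm_Bl// rmorphB/= -!(herm_sym bS).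
Qed.

Lemma herm_Zr c f h : S f -> S h -> b h (c *: f) = c^* * b h f.
Proof.
move=> Sf Sh; rewrite (herm_sym bS)//; last exact: herm_domZ.
by rewrite herm_Zl// rmorphM/= -(herm_sym bS).
Qed.

Lemma herm_sumr I (r : seq I) (Q : pred I) (c : I -> K) (w : I -> E) h :
  (forall i, S (w i)) -> S h ->
  b h (\sum_(i <- r | Q i) c i *: w i) = \sum_(i <- r | Q i) (c i)^* * b h (w i).
Proof.
move=> Sw Sh; rewrite (herm_sym bS)//; last exact: herm_dom_sum.
rewrite herm_suml// rmorph_sum/=; apply: eq_bigr => i _.
by rewrite rmorphM/= -(herm_sym bS).
Qed.

(** Finite Parseval identity: only diagonal terms survive. The predicate [Q] allows sums restricted
    to large indices, as needed for the tails of eigenfunction expansions. *)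
Lemma herm_sum_orth k (w : 'I_k -> E) (Q : pred 'I_k) (c e : 'I_k -> K) :
  (forall i, S (w i)) -> (forall i j, i != j -> b (w i) (w j) = 0) ->
  b (\sum_(i | Q i) c i *: w i) (\sum_(i | Q i) e i *: w i) =
  \sum_(i | Q i) c i * (e i)^* * b (w i) (w i).
Proof.
move=> Sw ow; rewrite herm_suml//; last exact: herm_dom_sum.
apply: eq_bigr => i Qi; rewrite herm_sumr// (bigD1 i)//= big1 ?addr0 ?mulrA//.
by move=> j /andP[_ ji]; rewrite ow ?mulr0// eq_sym.
Qed.

End hermitian_on.

(** * Measurability of open sets, and $L^2(\Omega)$ as a vector space *)

Lemma open_measurable_rV {R : realType} {d : nat} (U : set 'rV[R]_d) :
  open U -> measurable U.
Proof.
move=> oU.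
(* The sigma-algebra is generated by the coordinates, so an open set has to be exhibited as a
   countable union of coordinate boxes; those with rational corners contained in [U] suffice. *)
pose box (p : 'rV[rat]_d * 'rV[rat]_d) : set 'rV[R]_d :=
  \bigcap_(i in [set: 'I_d]) [set x | x 0 i \in `]ratr (p.1 0 i), ratr (p.2 0 i)[].
have mbox p : measurable (box p).
  apply: fin_bigcap_measurable => // i _.
  rewrite -[X in measurable X]setTI.
  exact: (@measurable_rV_coord R d i measurableT [set` `]_, _[]).
suff -> : U = \bigcup_p (if `[< box p `<=` U >] then box p else set0).
  apply: countable_bigcupT_measurable => [|p]; first exact: countableP.
  by case: ifP => _ //; exact: mbox.
apply/seteqP; split=> [x Ux|x [p _]]; last by case: asboolP => // sub /sub.
have /nbhs_ballP[e /= e0 xeU] := open_nbhs_nbhs (conj oU Ux).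
have /choice[q qP] i : exists q : rat, ratr q \in `]x 0 i - e, x 0 i[.
  by apply: rat_in_itvoo; rewrite ltrBlDr ltrDl.
have /choice[q' q'P] i : exists q : rat, ratr q \in `]x 0 i, x 0 i + e[.
  by apply: rat_in_itvoo; rewrite ltrDl.
exists (\row_i q i, \row_i q' i) => //.
case: asboolP => [_|[]].
  move=> i _ /=; rewrite !mxE in_itv/=.
  by have /itvP -> := qP i; have /itvP -> := q'P i.
(* Balls of row vectors are balls of the sup norm, so membership is checked coordinate by
   coordinate. *)
move=> y by_; apply: xeU; split => // i0 i; rewrite (ord1 i0).
have := by_ i I; rewrite /= !mxE in_itv/= => /andP[y1 y2].
rewrite /ball/= ltr_distlC; apply/andP; split.
  by apply: lt_trans y1; have /itvP -> := qP i.
by apply: lt_trans y2 _; have /itvP -> := q'P i.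
Qed.

Lemma Re_mul_conj {R : realType} (x y : R[i]) : complex.Re (x * y^*) =
  complex.Re x * complex.Re y + complex.Im x * complex.Im y.
Proof. by case: x y => [a b] [c e] /=; rewrite mulrN opprK. Qed.

Lemma Im_mul_conj {R : realType} (x y : R[i]) : complex.Im (x * y^*) =
  complex.Im x * complex.Re y - complex.Re x * complex.Im y.
Proof. by case: x y => [a b] [c e] /=; rewrite mulrN addrC. Qed.

Section L2_space.
Context {R : realType} {d : nat} {Om : set 'rV[R]_d}.
Hypothesis oOm : open Om.
Local Notation mu := (lebesgue_rV R d).
Local Notation fn := ('rV[R]_d -> R[i]).
Local Notation L2 := (L2 Om).
Local Notation L2dot := (L2dot Om).
Local Notation L2norm := (L2norm Om).
Local Notation aeq := (aeq Om).

Let mOm : measurable Om.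
Proof. exact: open_measurable_rV. Qed.

(** Young's inequality $|st|\le(s^2+t^2)/2$ on each product of components bounds both parts of
    $f\bar g$ by $|f|^2+|g|^2$. *)
Lemma L2_dot_integrable f g : L2 f -> L2 g ->
  mu.-integrable Om (EFin \o (fun x => complex.Re (f x * (g x)^*))) /\
  mu.-integrable Om (EFin \o (fun x => complex.Im (f x * (g x)^*))).
Proof.
move=> [mRf mIf If] [mRg mIg Ig].
have Ifg := integrableD mOm If Ig.
have normM (s t : R) : `|s * t| <= (s ^+ 2 + t ^+ 2) / 2.
  rewrite normrM -(real_normK (num_real s)) -(real_normK (num_real t)).
  by have := sqr_ge0 (`|s| - `|t|); nra.
split.
- rewrite (_ : (fun _ => _) = (fun x => complex.Re (f x) * complex.Re (g x) +
      complex.Im (f x) * complex.Im (g x))); last first.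
    by apply/funext => x; rewrite Re_mul_conj.
  apply: le_integrable Ifg => //.
    by apply/measurable_EFinP/measurable_funD; exact: measurable_funM.
  move=> x _ /=; rewrite lee_fin.
  apply: le_trans (ler_normD _ _) _; apply: le_trans (lerD (normM _ _) (normM _ _)) _.
  apply: le_trans (ler_norm _); nra.
- rewrite (_ : (fun _ => _) = (fun x => complex.Im (f x) * complex.Re (g x) -
      complex.Re (f x) * complex.Im (g x))); last first.
    by apply/funext => x; rewrite Im_mul_conj.
  apply: le_integrable Ifg => //.
    by apply/measurable_EFinP/measurable_funB; exact: measurable_funM.
  move=> x _ /=; rewrite lee_fin.
  apply: le_trans (ler_normB _ _) _; apply: le_trans (lerD (normM _ _) (normM _ _)) _.
  apply: le_trans (ler_norm _); nra.
Qed.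

Lemma L2_lin (c : R[i]) f g : L2 f -> L2 g -> L2 (c *: f + g).
Proof.
move=> L2f L2g; have [IRe IIm] := L2_dot_integrable L2f L2g.
case: (L2f) (L2g) => [mRf mIf If] [mRg mIg Ig].
case: c => [a b].
have ReE x : complex.Re (((a +i* b)%C *: f + g) x) =
    a * complex.Re (f x) - b * complex.Im (f x) + complex.Re (g x).
  by rewrite /GRing.add/GRing.scale/=; case: (f x) (g x) => [? ?] [? ?].
have ImE x : complex.Im (((a +i* b)%C *: f + g) x) =
    a * complex.Im (f x) + b * complex.Re (f x) + complex.Im (g x).
  by rewrite /GRing.add/GRing.scale/=; case: (f x) (g x) => [? ?] [? ?].
split.
- rewrite (funext ReE); apply: measurable_funD => //.
  by apply: measurable_funB; apply: measurable_funM.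
- rewrite (funext ImE); apply: measurable_funD => //.
  by apply: measurable_funD; apply: measurable_funM.
- under eq_fun do rewrite ReE ImE.
  (* With $c=a+ib$, $|cf+g|^2=|c|^2|f|^2+2a\,\mathrm{Re}(f\bar g)-2b\,\mathrm{Im}(f\bar g)+|g|^2$, a
     sum of four integrable terms. *)
  have I1 := integrableZl mOm (a ^+ 2 + b ^+ 2) If.
  have I2 := integrableZl mOm (2 * a) IRe.
  have I3 := integrableZl mOm (- (2 * b)) IIm.
  have := integrableD mOm (integrableD mOm (integrableD mOm I1 I2) I3) Ig.
  apply: eq_integrable => // x _ /=.
  rewrite -!EFinM -!EFinD Re_mul_conj Im_mul_conj; congr EFin; ring.
Qed.

End L2_space.

(** * The $L^2$ inner product, its norm, and compatibility with almost everywhere equality *)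

Section L2_hermitian.
Context {R : realType} {d : nat} {Om : set 'rV[R]_d}.
Hypothesis oOm : open Om.
Local Notation mu := (lebesgue_rV R d).
Local Notation fn := ('rV[R]_d -> R[i]).
Local Notation L2 := (L2 Om).
Local Notation L2dot := (L2dot Om).
Local Notation L2norm := (L2norm Om).
Local Notation aeq := (aeq Om).

Let mOm : measurable Om.
Proof. exact: open_measurable_rV. Qed.

Lemma L2_0 : L2 0.
Proof.
have z x : (0 : fn) x = 0 by [].
split; (under eq_fun do rewrite z/=).
- exact: measurable_cst.
- exact: measurable_cst.
- under eq_fun do rewrite expr0n addr0; exact: integrable0.
Qed.

Lemma fnlinE (c : R[i]) (f g : fn) x : (c *: f + g) x = c * f x + g x.
Proof. by []. Qed.

Lemma L2dot_lin c f g h : L2 f -> L2 g -> L2 h ->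
  L2dot (c *: f + g) h = c * L2dot f h + L2dot g h.
Proof.
move=> L2f L2g L2h.
have [IRf IIf] := L2_dot_integrable oOm L2f L2h.
have [IRg IIg] := L2_dot_integrable oOm L2g L2h.
have IZ k (v : _ -> R) : mu.-integrable Om (EFin \o v) ->
    mu.-integrable Om (EFin \o (fun x => k * v x)).
  by move=> /(integrableZl mOm k); apply: eq_integrable.
have ID (v w : _ -> R) : mu.-integrable Om (EFin \o v) ->
    mu.-integrable Om (EFin \o w) -> mu.-integrable Om (EFin \o (fun x => v x + w x)).
  by move=> Iv Iw; have := integrableD mOm Iv Iw; apply: eq_integrable.
have Re_lin (z w t : R[i]) : complex.Re ((c * z + w) * t) =
    complex.Re c * complex.Re (z * t) + (- complex.Im c) * complex.Im (z * t)
    + complex.Re (w * t).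
  by move: (c) z w t => [? ?] [? ?] [? ?] [? ?] /=; ring.
have Im_lin (z w t : R[i]) : complex.Im ((c * z + w) * t) =
    complex.Re c * complex.Im (z * t) + complex.Im c * complex.Re (z * t)
    + complex.Im (w * t).
  by move: (c) z w t => [? ?] [? ?] [? ?] [? ?] /=; ring.
apply/eqP; rewrite eq_complex; apply/andP; split; apply/eqP.
- rewrite [LHS]/=; under eq_Rintegral do rewrite fnlinE Re_lin.
  rewrite RintegralD//; last first.
    by apply: ID; exact: IZ.
  rewrite RintegralD//; try exact: IZ.
  rewrite !RintegralZl//.
  by move: (c) => [? ?] /=; ring.
- rewrite [LHS]/=; under eq_Rintegral do rewrite fnlinE Im_lin.
  rewrite RintegralD//; last first.
    by apply: ID; exact: IZ.
  rewrite RintegralD//; try exact: IZ.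
  rewrite !RintegralZl//.
  by move: (c) => [? ?] /=; ring.
Qed.

Lemma L2dot_sym f g : L2 f -> L2 g -> L2dot f g = (L2dot g f)^*.
Proof.
move=> L2f L2g; have [IR II] := L2_dot_integrable oOm L2g L2f.
have sym (z w : R[i]) : z * w^* = (w * z^*)^*.
  by rewrite rmorphM/= conjCK mulrC.
have Rec (z : R[i]) : complex.Re z^* = complex.Re z by case: z.
have Imc (z : R[i]) : complex.Im z^* = (-1) * complex.Im z.
  by case: z => ? ? /=; rewrite mulN1r.
apply/eqP; rewrite eq_complex; apply/andP; split; apply/eqP.
- rewrite Rec [LHS]/= [RHS]/=; apply: eq_Rintegral => x _.
  by rewrite [in LHS]sym Rec.
- rewrite Imc [LHS]/= [X in _ * X]/= -RintegralZl//; apply: eq_Rintegral => x _.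
  by rewrite [in LHS]sym Imc.
Qed.

Lemma L2dot_herm : hermitian_on L2 L2dot.
Proof.
split; [exact: L2_0|exact: L2_lin oOm|exact: L2dot_lin|exact: L2dot_sym].
Qed.

Lemma L2dot_real f : (complex.Re (L2dot f f))%:C%C = L2dot f f.
Proof.
rewrite /Defs.L2dot/=; apply/eqP; rewrite eq_complex/= eqxx/= eq_sym; apply/eqP.
rewrite /Rintegral integral0_eq// => x _; rewrite Im_mul_conj.
by rewrite mulrC subrr.
Qed.

Lemma Re_L2dot_ge0 f : 0 <= complex.Re (L2dot f f).
Proof.
apply: Rintegral_ge0 => x _; rewrite Re_mul_conj.
by rewrite addr_ge0// -expr2 sqr_ge0.
Qed.

Lemma L2norm_ge0 f : 0 <= L2norm f.
Proof. exact: sqrtr_ge0. Qed.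

Lemma L2norm_sqr f : L2norm f ^+ 2 = complex.Re (L2dot f f).
Proof. by rewrite sqr_sqrtr// Re_L2dot_ge0. Qed.

Lemma L2dot_normE f : L2dot f f = (L2norm f ^+ 2)%:C%C.
Proof. by rewrite L2norm_sqr L2dot_real. Qed.

Lemma aeq_refl f : aeq f f.
Proof. by apply: nearW => x. Qed.

Lemma aeq_sym f g : aeq f g -> aeq g f.
Proof. by apply: filterS => x fg /fg. Qed.

Lemma aeq_trans f g h : aeq f g -> aeq g h -> aeq f h.
Proof. by apply: filterS2 => x fg gh Ox; rewrite fg// gh. Qed.

Lemma aeq_lin c f f' g g' : aeq f f' -> aeq g g' -> aeq (c *: f + g) (c *: f' + g').
Proof. by apply: filterS2 => x ff' gg' Ox; rewrite !fnlinE ff'// gg'. Qed.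

Lemma L2norm0_aeq f : L2 f -> L2norm f = 0 -> aeq f 0.
Proof.
move=> L2f nf0; have [IR _] := L2_dot_integrable oOm L2f L2f.
have := L2norm_sqr f; rewrite nf0 expr0n/= /Rintegral => /esym I0.
(* [Rintegral] is the [fine] part of an extended integral, so its vanishing alone would not exclude
   an infinite integral; integrability does, and a nonnegative integrand with zero integral vanishes
   almost everywhere. *)
have : (\int[mu]_(x in Om) `|(complex.Re (f x * (f x)^*))%:E| = 0)%E.
  transitivity (fine (\int[mu]_(x in Om) (complex.Re (f x * (f x)^*))%:E)%E)%:E.
    rewrite fineK; last exact: integrable_fin_num.
    apply: eq_integral => x _; rewrite /= ger0_norm// Re_mul_conj.
    by rewrite addr_ge0// -expr2 sqr_ge0.
  by rewrite I0.
move=> /ae_eq_integral_abs - /(_ mOm (measurable_int _ IR)).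
apply: filterS => x fx0 Ox; have := fx0 Ox; rewrite /= Re_mul_conj => -[].
rewrite -!expr2 => /eqP; rewrite paddr_eq0 ?sqr_ge0// !sqrf_eq0 => /andP[/eqP r0 /eqP i0].
by change (f x = 0); move: r0 i0; case: (f x) => /= ? ? -> ->.
Qed.

Lemma aeq_L2dotl f g h : L2 f -> L2 g -> L2 h -> aeq f g -> L2dot f h = L2dot g h.
Proof.
move=> L2f L2g L2h fg.
have [IRf IIf] := L2_dot_integrable oOm L2f L2h.
have [IRg IIg] := L2_dot_integrable oOm L2g L2h.
rewrite /Defs.L2dot/Rintegral; congr (fine _ +i* fine _)%C.
- apply: ae_eq_integral => //; [exact: measurable_int IRf|exact: measurable_int IRg|].
  by apply: filterS fg => x fg Ox; rewrite fg.
- apply: ae_eq_integral => //; [exact: measurable_int IIf|exact: measurable_int IIg|].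
  by apply: filterS fg => x fg Ox; rewrite fg.
Qed.

Lemma aeq_L2norm f g : L2 f -> L2 g -> aeq f g -> L2norm f = L2norm g.
Proof.
move=> L2f L2g fg; rewrite /Defs.L2norm (aeq_L2dotl L2f L2g)//.
by rewrite L2dot_sym// (aeq_L2dotl L2f L2g)// -L2dot_sym.
Qed.

Lemma L2norm_scale (c : R) f : L2 f -> L2norm (c%:C%C *: f) = `|c| * L2norm f.
Proof.
move=> L2f; rewrite /Defs.L2norm (herm_Zl L2dot_herm)//; last first.
  exact: herm_domZ L2dot_herm _ _ L2f.
rewrite (herm_Zr L2dot_herm)// L2dot_normE.
rewrite -sqrtr_sqr -sqrtrM ?sqr_ge0//; congr Num.sqrt => /=; ring.
Qed.

Lemma L2norm_sqrD f g : L2 f -> L2 g -> L2norm (f + g) ^+ 2 =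
  L2norm f ^+ 2 + 2 * complex.Re (L2dot f g) + L2norm g ^+ 2.
Proof.
move=> L2f L2g; have L2fg := herm_domD L2dot_herm L2f L2g.
rewrite !L2norm_sqr (herm_Dl L2dot_herm)// !(herm_Dr L2dot_herm)//.
rewrite [L2dot g f]L2dot_sym//.
by case: (L2dot f f) (L2dot f g) (L2dot g g) => [? ?] [? ?] [? ?] /=; ring.
Qed.

(** Cauchy-Schwarz for the real part, from the nonnegativity of $\|sf+tg\|^2$ as a quadratic form in
    real $s,t$. *)
Lemma Re_L2dot_le f g : L2 f -> L2 g ->
  complex.Re (L2dot f g) <= L2norm f * L2norm g.
Proof.
move=> L2f L2g.
have q (s t : R) : 0 <= s ^+ 2 * L2norm f ^+ 2
    + 2 * s * t * complex.Re (L2dot f g) + t ^+ 2 * L2norm g ^+ 2.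
  have L2sf : L2 (s%:C%C *: f) by exact: herm_domZ L2dot_herm _ _ L2f.
  have L2tg : L2 (t%:C%C *: g) by exact: herm_domZ L2dot_herm _ _ L2g.
  have := sqr_ge0 (L2norm (s%:C%C *: f + t%:C%C *: g)).
  rewrite L2norm_sqrD// !L2norm_scale// !exprMn !real_normK ?num_real//.
  rewrite (herm_Zl L2dot_herm)// (herm_Zr L2dot_herm)//.
  by case: (L2dot f g) => /= ? ?; rewrite !(mul0r, oppr0, subr0, mulr0, addr0); lra.
have := L2norm_ge0 f; have := L2norm_ge0 g.
set x := L2norm f in q *; set y := L2norm g in q *; set z := complex.Re _ in q *.
move=> y0 x0; rewrite leNgt; apply/negP => xyz.
have z0 : 0 < z by apply: le_lt_trans xyz; exact: mulr_ge0.
have qz w : z * ((w ^+ 2 + 1) / z) = w ^+ 2 + 1 by field; rewrite gt_eqF.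
have [x1|x1] := eqVneq x 0.
  (* When [x] is 0 the quadratic form is $2stz+t^2y^2$; this choice makes it $-2(y^2+1)+y^2<0$. The
     case where [y] is 0 is symmetric. *)
  have := q ((y ^+ 2 + 1) / z) (-1); rewrite x1 => h.
  by have := qz y; have := sqr_ge0 y; nra.
have [y1|y1] := eqVneq y 0.
  have := q 1 (- ((x ^+ 2 + 1) / z)); rewrite y1 => h.
  by have := qz x; have := sqr_ge0 x; nra.
have xy0 : 0 < x * y by rewrite mulr_gt0// lt_def ?x1 ?y1.
(* At $(s,t)=(y,-x)$ the form factors as $2xy(xy-z)$, which is negative if $z>xy>0$. *)
have := q y (- x); rewrite (_ : _ + _ = 2 * (x * y) * (x * y - z)); last by ring.
by rewrite pmulr_rge0 ?subr_ge0 ?leNgt ?xyz// mulr_gt0.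
Qed.

Lemma L2norm_triangle f g : L2 f -> L2 g -> L2norm (f + g) <= L2norm f + L2norm g.
Proof.
move=> L2f L2g; rewrite -(ler_sqr (L2norm_ge0 _)) ?nnegrE ?addr_ge0 ?L2norm_ge0//.
by rewrite L2norm_sqrD// sqrrD; have := Re_L2dot_le L2f L2g; lra.
Qed.

End L2_hermitian.

(** * Spans in $L^2(\Omega)$ and biorthogonal families *)

Section L2_span.
Context {R : realType} {d : nat} {Om : set 'rV[R]_d}.
Hypothesis oOm : open Om.
Local Notation fn := ('rV[R]_d -> R[i]).
Local Notation L2 := (L2 Om).
Local Notation L2dot := (L2dot Om).
Local Notation aeq := (aeq Om).

Lemma aeq_L2dotr (f g h : fn) : L2 f -> L2 g -> L2 h -> aeq f g -> L2dot h f = L2dot h g.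
Proof.
by move=> L2f L2g L2h fg; rewrite L2dot_sym// (aeq_L2dotl oOm L2f L2g)// -L2dot_sym.
Qed.

Lemma aeq_sum k (c : 'I_k -> R[i]) (v w : 'I_k -> fn) :
  (forall j, aeq (v j) (w j)) -> aeq (\sum_j c j *: v j) (\sum_j c j *: w j).
Proof.
move=> vw; elim/big_ind2: _ => [|f f' g g' ff' gg'|j _]; first exact: aeq_refl.
  by rewrite -[f]scale1r -[f']scale1r; exact: aeq_lin.
by rewrite -[_ *: v j]addr0 -[_ *: w j]addr0; apply: aeq_lin => //; exact: aeq_refl.
Qed.

Lemma L2_sum k (c : 'I_k -> R[i]) (w : 'I_k -> fn) :
  (forall j, L2 (w j)) -> L2 (\sum_j c j *: w j).
Proof. by move=> L2w; exact: (herm_dom_sum (L2dot_herm oOm)). Qed.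

Lemma L2span_sum k (c : 'I_k -> R[i]) (w : 'I_k -> fn) :
  (forall j, L2 (w j)) -> L2span Om w (\sum_j c j *: w j).
Proof. by move=> L2w; split; [exact: L2_sum|exists c; exact: aeq_refl]. Qed.

Lemma sum_delta k (w : 'I_k -> fn) j : w j = \sum_i (i == j)%:R *: w i.
Proof.
rewrite (bigD1 j)//= eqxx scale1r big1 ?addr0// => i /negPf ->.
by rewrite scale0r.
Qed.

Lemma L2span_mem k (w : 'I_k -> fn) j : (forall j, L2 (w j)) -> L2span Om w (w j).
Proof. by move=> L2w; rewrite (sum_delta w j); exact: L2span_sum. Qed.

Lemma L2span_scale k (w : 'I_k -> fn) c f : L2span Om w f -> L2span Om w (c *: f).
Proof.
move=> [L2f [e fe]]; split; first exact: herm_domZ (L2dot_herm oOm) _ _ L2f.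
exists (fun j => c * e j).
have := aeq_lin c fe (aeq_refl 0); rewrite !addr0 scaler_sumr.
by under eq_bigr do rewrite scalerA.
Qed.

Lemma sum_mulmx k l (c : 'rV[R[i]]_k) (A : 'M[R[i]]_(k, l)) (w : 'I_l -> fn) :
  \sum_i c 0 i *: (\sum_j A i j *: w j) = \sum_j (c *m A) 0 j *: w j.
Proof.
under eq_bigr do rewrite scaler_sumr.
rewrite exchange_big; apply: eq_bigr => j _; rewrite mxE scaler_suml.
by under eq_bigr do rewrite scalerA.
Qed.

Lemma L2span_sub k l (v : 'I_k -> fn) (w : 'I_l -> fn) :
  (forall i, L2span Om w (v i)) -> L2span Om v `<=` L2span Om w.
Proof.
move=> vw f [L2f [c fc]]; split => //.
have /choice[A vA] i := (vw i).2.
exists (fun j => (\row_i c i *m \matrix_(i, j) A i j) 0 j).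
rewrite -sum_mulmx; apply: aeq_trans fc _.
under [X in Defs.aeq _ _ X]eq_bigr => i _ do
  (rewrite mxE; under eq_bigr do rewrite mxE).
exact: aeq_sum.
Qed.

Lemma aeq_L2dot_suml k (c : 'I_k -> R[i]) (w : 'I_k -> fn) f g :
  L2 f -> (forall j, L2 (w j)) -> L2 g -> aeq f (\sum_j c j *: w j) ->
  L2dot f g = \sum_j c j * L2dot (w j) g.
Proof.
move=> L2f L2w L2g fc; rewrite (aeq_L2dotl oOm _ _ _ fc)//; last exact: L2_sum.
by rewrite (herm_suml (L2dot_herm oOm)).
Qed.

Section biorthogonal.
Variables (k : nat) (v g : 'I_k -> fn) (D : 'I_k -> R[i]).
Hypotheses (L2v : forall i, L2 (v i)) (L2g : forall i, L2 (g i)).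
Hypothesis D0 : forall i, D i != 0.
Hypothesis vg : forall i j, L2dot (v i) (g j) = (i == j)%:R * D j.

(** Pairing a vanishing combination with [g j] isolates the [j]-th coefficient. It replaces
    dimension arguments both for the moving bases and for the limit. *)
Lemma biorth_lin_indep : lin_indep Om v.
Proof.
move=> c /aeq_sym cv j; have := aeq_L2dot_suml (L2_0 (Om := Om)) L2v (L2g j) cv.
rewrite (herm_0l (L2dot_herm oOm))// (bigD1 j)//= vg eqxx mul1r big1 ?addr0.
  by move/esym/eqP; rewrite mulf_eq0 (negPf (D0 j)) orbF => /eqP.
by move=> i /negPf ij; rewrite vg ij mul0r mulr0.
Qed.

(** A dimension count in matrix form: if [A] expresses [v] in [w], the pairings of [w] with [g],
    scaled by [D], give a right inverse of [A]. Since [A] is square this is also a left inverse, and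
    it expresses [w] in [v]. *)
Lemma biorth_L2spanE (w : 'I_k -> fn) : (forall i, L2 (w i)) ->
  (forall i, L2span Om w (v i)) -> L2span Om v = L2span Om w.
Proof.
move=> L2w vw; apply/seteqP; split; first exact: L2span_sub.
have /choice[A0 vA0] i := (vw i).2.
pose A := \matrix_(i, j) A0 i j.
have vA i : aeq (v i) (\sum_j A i j *: w j).
  by under [X in Defs.aeq _ _ X]eq_bigr do rewrite mxE.
pose B := \matrix_(j, l) (L2dot (w j) (g l) / D l).
have AB : A *m B = 1%:M.
  apply/matrixP => i l; rewrite !mxE; transitivity (L2dot (v i) (g l) / D l).
    rewrite (aeq_L2dot_suml _ _ _ (vA i))// mulr_suml; apply: eq_bigr => j _.
    by rewrite [B _ _]mxE mulrA.
  by rewrite vg mulfK.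
have BA := mulmx1C AB.
apply: L2span_sub => j; split => //; exists (fun i => B j i).
have := aeq_sum (row j B 0) vA; rewrite sum_mulmx -row_mul BA => /aeq_sym.
under eq_bigr do rewrite !mxE eq_sym; rewrite -sum_delta.
by under eq_bigr do rewrite mxE.
Qed.

End biorthogonal.

End L2_span.

(** * The solution operator: symmetry, linearity and action on eigenfunctions *)

Section solution_operator.
Context {R : realType} {d : nat} {Om : set 'rV[R]_d} {m : nat}.
Context {V : set ('rV[R]_d -> R[i])}.
Context {a : ('rV[R]_d -> R[i]) -> ('rV[R]_d -> R[i]) -> R[i]}.
Context {Linv : ('rV[R]_d -> R[i]) -> ('rV[R]_d -> R[i])}.
Context {lam : nat -> R} {phi : nat -> ('rV[R]_d -> R[i])}.
Hypotheses (oOm : open Om) (V_sob : sobolev_space Om m V).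
Hypothesis a_form : bounded_hermitian_form Om m V a.
Hypothesis a_pos : positive_definite Om V a.
Hypothesis L_wp : well_posed Om m V a Linv.
Hypothesis phi_eig : eigensystem Om m V Linv lam phi.
Local Notation fn := ('rV[R]_d -> R[i]).
Local Notation L2 := (L2 Om).
Local Notation L2dot := (L2dot Om).
Local Notation L2norm := (L2norm Om).
Local Notation aeq := (aeq Om).
Let dotH := L2dot_herm oOm.

Lemma L2norm_le_sobolev f : L2norm f <= sobolev_norm Om m f.
Proof.
rewrite -[L2norm f]ger0_norm ?L2norm_ge0// -sqrtr_sqr ler_wsqrtr//.
pose al0 : {ffun 'I_d -> 'I_m.+1} := [ffun=> ord0].
have z0 : mabs (fun i => al0 i) = 0%N.
  by rewrite /mabs big1// => i _; rewrite ffunE.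
rewrite (bigD1 al0)/=; last by rewrite z0.
by rewrite /wderiv z0/= lerDl sumr_ge0// => al _; exact: sqr_ge0.
Qed.

Lemma V_L2 f : V f -> L2 f.
Proof. by move=> /(sobolev_space_sub V_sob)[]. Qed.

Lemma form_hermitian : hermitian_on V a.
Proof.
split.
(* Closure of [V] is stated for $cf+g$ only, so 0 is written as $-\phi+\phi$ with an element known
   to lie in [V]. *)
- rewrite -(addNr (phi 0)) -scaleN1r.
  by apply: (sobolev_space_lin V_sob); exact: eigen_in phi_eig _.
- exact: sobolev_space_lin V_sob.
- exact: form_lin a_form.
- exact: form_herm a_form.
Qed.

Let aH := form_hermitian.

Lemma form_eq0 v : V v -> a v v = 0 -> aeq v 0.
Proof.
move=> Vv avv0; apply: contrapT => /(a_pos Vv).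
by rewrite avv0 ltxx.
Qed.

Lemma Linv_V f : L2 f -> V (Linv f).
Proof. by move=> /(well_posed_ex L_wp)[]. Qed.

Lemma Linv_form f v : L2 f -> V v -> a (Linv f) v = L2dot f v.
Proof. by move=> /(well_posed_ex L_wp)[_]; exact. Qed.

(** Both sides equal $a(\mathcal{L}^{-1}f,\mathcal{L}^{-1}g)$, by Hermitian symmetry. *)
Lemma Linv_sym f g : L2 f -> L2 g -> L2dot (Linv f) g = L2dot f (Linv g).
Proof.
move=> L2f L2g; have [Vf Vg] := (Linv_V L2f, Linv_V L2g).
rewrite -(Linv_form L2f Vg) (form_herm a_form)// Linv_form// -(L2dot_sym oOm)//.
exact: V_L2.
Qed.

(** [Linv] is determined only up to [aeq]; its additivity and its values on eigenfunction sums are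
    all obtained by testing a candidate in the weak equation. *)
Lemma Linv_aeq f u : L2 f -> V u -> (forall v, V v -> a u v = L2dot f v) ->
  aeq (Linv f) u.
Proof. by move=> L2f Vu uf; apply/aeq_sym/(well_posed_uniq L_wp L2f). Qed.

Lemma LinvD f g : L2 f -> L2 g -> aeq (Linv (f + g)) (Linv f + Linv g).
Proof.
move=> L2f L2g; have [Vf Vg] := (Linv_V L2f, Linv_V L2g).
apply: Linv_aeq => [||v Vv]; [exact: herm_domD dotH _ _ _ _|exact: herm_domD aH _ _ _ _|].
by rewrite (herm_Dl aH)// (herm_Dl dotH) ?Linv_form//; exact: V_L2.
Qed.

Lemma LinvB f g : L2 f -> L2 g -> aeq (Linv (f - g)) (Linv f - Linv g).
Proof.
move=> L2f L2g; have [Vf Vg] := (Linv_V L2f, Linv_V L2g).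
apply: Linv_aeq => [||v Vv]; [exact: herm_domB dotH _ _ _ _|exact: herm_domB aH _ _ _ _|].
by rewrite (herm_Bl aH)// (herm_Bl dotH) ?Linv_form//; exact: V_L2.
Qed.

Lemma eigen_V i : V (phi i).
Proof. exact: eigen_in phi_eig i. Qed.

Lemma eigen_L2 i : L2 (phi i).
Proof. exact: V_L2 (eigen_V i). Qed.

Lemma eigen_dot_neq0 i : L2dot (phi i) (phi i) != 0.
Proof.
apply/eqP => d0; apply: (eigen_neq0 phi_eig (i := i)).
apply: (L2norm0_aeq oOm (eigen_L2 i)).
by rewrite /Defs.L2norm d0 /= sqrtr0.
Qed.

Lemma Linv_eigen_sum k (Q : pred 'I_k) (c : 'I_k -> R[i]) :
  aeq (Linv (\sum_(i | Q i) c i *: phi i))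
      (\sum_(i | Q i) (c i * (lam i)%:C%C) *: phi i).
Proof.
have [L2phi Vphi] : (forall i : 'I_k, L2 (phi i)) /\ (forall i : 'I_k, V (phi i)).
  by split=> i; [exact: eigen_L2|exact: eigen_V].
apply: Linv_aeq => [||v Vv]; [exact: (herm_dom_sum dotH)|exact: (herm_dom_sum aH)|].
have L2v := V_L2 Vv.
rewrite (herm_suml aH)// (herm_suml dotH)//; apply: eq_bigr => i _.
rewrite -mulrA -(herm_Zl aH)// -(form_aeq a_form _ _ _ (eigen_eq phi_eig i))//.
- by rewrite Linv_form.
- exact: Linv_V.
- exact: herm_domZ aH _ _ _.
Qed.

Lemma Linv_dot_eigen f k : L2 f ->
  L2dot (Linv f) (phi k) = (lam k)%:C%C * L2dot f (phi k).
Proof.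
move=> L2f; have L2k := eigen_L2 k.
rewrite Linv_sym// (aeq_L2dotr oOm _ _ _ (eigen_eq phi_eig k))//.
- by rewrite (herm_Zr dotH)//; congr (_ * _); apply/eqP; rewrite eq_complex/= oppr0 !eqxx.
- exact/V_L2/Linv_V.
- exact: herm_domZ dotH _ _ _.
Qed.

(** * Norm of the solution operator away from the first $N$ eigenfunctions *)

Lemma L2norm_orth_le f g : L2 f -> L2 g -> L2dot f g = 0 -> L2norm f <= L2norm (f + g).
Proof.
move=> L2f L2g fg0; rewrite -ler_sqr ?nnegrE ?L2norm_ge0//.
by rewrite (L2norm_sqrD oOm)// fg0/= mulr0 addr0 lerDl sqr_ge0.
Qed.

Lemma L2norm_eigen_sum k (Q : pred 'I_k) (c : 'I_k -> R[i]) :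
  L2norm (\sum_(i | Q i) c i *: phi i) ^+ 2 =
  \sum_(i | Q i) complex.Re (c i * (c i)^* * L2dot (phi i) (phi i)).
Proof.
rewrite L2norm_sqr (herm_sum_orth dotH) => [|i|i j ij]; first 1 last.
- exact: eigen_L2.
- exact: (eigen_orth phi_eig).
- by elim/big_ind2: _ => // ? [? ?] ? [? ?] /= -> ->.
Qed.

(** [Linv] multiplies the [i]-th coefficient by [lam i], which is at most [lam N] for $i\ge N$, so
    the squared norms compare term by term. *)
Lemma Linv_tail_le N k (c : 'I_k -> R[i]) :
  L2norm (Linv (\sum_(i < k | (N <= i)%N) c i *: phi i)) <=
  lam N * L2norm (\sum_(i < k | (N <= i)%N) c i *: phi i).
Proof.
have L2phi (i : 'I_k) : L2 (phi i) by exact: eigen_L2.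
rewrite (aeq_L2norm oOm _ _ (Linv_eigen_sum _ c)); first 1 last.
- by apply/V_L2/Linv_V/(herm_dom_sum dotH).
- exact: (herm_dom_sum dotH).
have lam0 := eigen_ge0 phi_eig.
rewrite -ler_sqr ?nnegrE ?mulr_ge0 ?L2norm_ge0// exprMn !L2norm_eigen_sum mulr_sumr.
apply: ler_sum => i Ni; rewrite L2dot_normE.
have -> : complex.Re (c i * (lam i)%:C%C * (c i * (lam i)%:C%C)^*
      * (L2norm (phi i) ^+ 2)%:C%C) =
    lam i ^+ 2 * complex.Re (c i * (c i)^* * (L2norm (phi i) ^+ 2)%:C%C).
  by case: (c i) => ? ? /=; ring.
apply: ler_wpM2r; last by rewrite ler_sqr ?nnegrE// (eigen_noninc phi_eig).
by case: (c i) => x y /=; have := sqr_ge0 x; have := sqr_ge0 y;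
  have := sqr_ge0 (L2norm (phi i)); nra.
Qed.

Lemma Linv_bounded : exists2 B, 0 <= B & forall f, L2 f -> L2norm (Linv f) <= B * L2norm f.
Proof.
have [B BP] := well_posed_bounded L_wp; exists `|B| => // f L2f.
apply: le_trans (L2norm_le_sobolev _) _; apply: le_trans (BP _ L2f) _.
by rewrite ler_wpM2r ?L2norm_ge0 ?ler_norm.
Qed.

(** By completeness [r] is close to a finite eigenfunction sum. Its tail of indices at least [N]
    obeys [Linv_tail_le], and the remainder is small and controlled by the boundedness of [Linv]. *)
Lemma Linv_contract N r : V r -> (forall i, (i < N)%N -> L2dot r (phi i) = 0) ->
  L2norm (Linv r) <= lam N * L2norm r.
Proof.
move=> Vr rphi; have L2r := V_L2 Vr; have [B B0 BP] := Linv_bounded.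
have lam0 := eigen_ge0 phi_eig N.
apply/ler_addgt0Pr => e e0.
(* The total error is at most $e'(\lambda+B)$, where $\lambda$ is [lam N]; the extra 1 keeps the
   denominator positive. *)
pose e' := e / (lam N + B + 1).
have e'0 : 0 < e' by rewrite divr_gt0//; nra.
have [k [c kc]] := eigen_complete phi_eig Vr e'0.
have {}kc := le_lt_trans (L2norm_le_sobolev _) kc.
have L2phi (i : 'I_k) : L2 (phi i) by exact: eigen_L2.
pose tail := \sum_(i < k | (N <= i)%N) c i *: phi i.
pose head := \sum_(i < k | ~~ (N <= i)%N) c i *: phi i.
have sumE : \sum_(i < k) c i *: phi i = tail + head by rewrite (bigID (fun i : 'I_k => N <= i)%N).
have L2t : L2 tail by exact: (herm_dom_sum dotH).
have L2h : L2 head by exact: (herm_dom_sum dotH).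
have L2rt : L2 (r - tail) by exact: (herm_domB dotH).
have rt : L2norm (r - tail) <= e'.
  (* Both [r] and [tail] are orthogonal to [head], so dropping [head] from the approximation can
     only reduce the distance to [r]. *)
  apply: le_trans (ltW kc); rewrite sumE opprD addrA; apply: L2norm_orth_le => //.
    by rewrite -scaleN1r; exact: (herm_domZ dotH).
  rewrite -[- head]scaleN1r (herm_Zr dotH)// (herm_sumr dotH)// big1 ?mulr0// => i.
  rewrite -ltnNge => iN; rewrite (herm_Bl dotH)// rphi// sub0r (herm_suml dotH)//.
  rewrite big1 ?oppr0 ?mulr0// => j Nj; rewrite (eigen_orth phi_eig) ?mulr0//.
  by apply: contraTneq iN => <-; rewrite -leqNgt.
have tr : L2norm tail <= L2norm r + e'.
  have -> : tail = r + (-1)%:C%C *: (r - tail).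
    by rewrite rmorphN1 scaleN1r opprB addrC subrK.
  apply: le_trans (L2norm_triangle oOm _ _) _ => //; first exact: (herm_domZ dotH).
  by rewrite (L2norm_scale oOm)// normrN1 mul1r lerD2l.
have -> : r = tail + (r - tail) by rewrite addrC subrK.
rewrite (aeq_L2norm oOm _ _ (LinvD L2t L2rt)); first 1 last.
- by apply/V_L2/Linv_V/(herm_domD dotH).
- by apply: (herm_domD dotH); exact/V_L2/Linv_V.
apply: le_trans (L2norm_triangle oOm _ _) _; [exact/V_L2/Linv_V..|].
have -> : tail + (r - tail) = r by rewrite addrC subrK.
apply: le_trans (lerD (Linv_tail_le _ _) (BP _ L2rt)) _.
have -> : e = e' * (lam N + B + 1) by rewrite mulfVK// gt_eqF//; nra.
by have := ler_wpM2l lam0 tr; have := ler_wpM2l B0 rt; nra.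
Qed.

(** * The iterated spaces and their relation to the solution operator *)

Context {N : nat} {u : nat -> 'I_N -> ('rV[R]_d -> R[i])}.
Context {C : nat -> ('rV[R]_d -> R[i]) -> ('rV[R]_d -> R[i])}.
Hypothesis u_iod : iod Om V a u C.

Lemma iod_V n j : V (u n j).
Proof.
by case: n => [|n]; [exact: (iod_init u_iod)|have [] := iod_basis u_iod n j].
Qed.

Lemma iod_L2 n j : L2 (u n j).
Proof. exact/V_L2/iod_V. Qed.

Lemma iod_form_W n k w : iod_W Om V u n w -> a (u n.+1 k) w = 0.
Proof.
move=> [Vw qw]; have [_ [xi [axi _]]] := iod_basis u_iod n k.
have := axi _ Vw; rewrite big1 ?addr0// => j _.
by rewrite qw mulr0.
Qed.

(* Subtracting the combination of the biorthogonal basis with the same values of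
   the q_j leaves an element of W^n that is orthogonal to W^n. *)
Lemma iod_span_orth n w : V w -> (forall z, iod_W Om V u n z -> a w z = 0) ->
  L2span Om (u n.+1) w.
Proof.
move=> Vw wW; split; first exact: V_L2.
(* [iod_q] is conjugate-linear in its argument, hence the conjugate in the coefficients. *)
pose c k := (iod_q Om u n k w)^*.
exists c; set s := \sum_j _.
have Vs : V s by apply: (herm_dom_sum aH) => j; exact: iod_V.
have Vws : V (w - s) by exact: (herm_domB aH).
have Wws : iod_W Om V u n (w - s).
  split=> // j; have L2u := iod_L2 n; have L2u1 := iod_L2 n.+1.
  have [L2w L2s] := (V_L2 Vw, V_L2 Vs).
  rewrite /iod_q (herm_Br dotH)// (herm_sumr dotH)//.
  rewrite (bigD1 j)//= big1 => [|i /negPf ij].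
    have [_ [xi [_ /(_ j)]]] := iod_basis u_iod n j; rewrite /iod_q eqxx => ->.
    by rewrite mulr1 addr0 /c conjCK subrr.
  have [_ [xi [_ /(_ j)]]] := iod_basis u_iod n i; rewrite /iod_q eq_sym ij => ->.
  by rewrite mulr0.
have ws0 : a (w - s) (w - s) = 0.
  rewrite (herm_Bl aH)// wW// sub0r (herm_suml aH) => [|j|//]; last exact: iod_V.
  by rewrite big1 ?oppr0// => j _; rewrite iod_form_W ?mulr0.
by have := aeq_lin 1 (form_eq0 Vws ws0) (aeq_refl (Om := Om) s); rewrite !scale1r subrK add0r.
Qed.

(** Elements of $(1-\mathcal{C}^n)V$ are [a]-orthogonal to $W^n$, so [iod_span_orth] applies.
    Conversely, for [s] in the span of the new basis,
    $a(\mathcal{C}^ns,\mathcal{C}^ns)=a(s,\mathcal{C}^ns)=0$, so $s=s-\mathcal{C}^ns$. *)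
Lemma iod_spaceE n : iod_space Om V u C n = L2span Om (u n).
Proof.
case: n => [//|n]; apply/seteqP; split=> [f [L2f [v [Vv fv]]]|f [L2f [c fc]]].
- have [[VCv _] aCv] := iod_proj u_iod n Vv.
  have VvC : V (v - C n v) by exact: (herm_domB aH).
  have [|_ [c vc]] := iod_span_orth (n := n) VvC.
    by move=> z Wz; rewrite (herm_Bl aH) ?aCv ?subrr//; case: Wz.
  by split=> //; exists c; exact: aeq_trans fv vc.
- set s := \sum_j _ in fc; split=> //; exists s.
  have Vs : V s by apply: (herm_dom_sum aH) => j; exact: iod_V.
  split=> //; have [WCs aCs] := iod_proj u_iod n Vs.
  have VCs := WCs.1.
  have Cs0 : aeq (C n s) 0.
    apply: form_eq0 => //; rewrite aCs// (herm_suml aH) => [|j|//]; last exact: iod_V.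
    by rewrite big1// => j _; rewrite iod_form_W ?mulr0.
  apply: aeq_trans fc _; apply: aeq_sym.
  by have := aeq_lin (-1) Cs0 (aeq_refl (Om := Om) s); rewrite scaler0 add0r scaleN1r addrC.
Qed.

(** For [z] in $W^n$, $a(\mathcal{L}^{-1}f,z)=(f,z)=0$ because [f] is a combination of the $u_j^n$.
    Only this inclusion is stated; that bases are carried to bases follows from biorthogonality. *)
Lemma Linv_iod_span n f : L2span Om (u n) f -> L2span Om (u n.+1) (Linv f).
Proof.
move=> [L2f [c fc]]; apply: iod_span_orth => [|z [Vz qz]]; first exact: Linv_V.
rewrite Linv_form// (aeq_L2dot_suml oOm _ _ _ fc)//; last 2 first.
- exact: iod_L2.
- exact: V_L2.
by rewrite big1// => j _; have := qz j; rewrite /iod_q => ->; rewrite mulr0.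
Qed.

(** * The basis adapted to the eigenfunctions, and convergence *)

Lemma eigen_adapted_basis (PN : fn -> fn) :
  orth_projector Om (L2span Om (fun j : 'I_N => phi j)) PN ->
  lin_indep Om (fun j => PN (u 0%N j)) ->
  exists v : 'I_N -> fn, [/\ forall i, V (v i), forall i, L2span Om (u 0%N) (v i)
    & forall i k : 'I_N, L2dot (v i) (phi k) = (i == k)%:R * L2dot (phi k) (phi k)].
Proof.
move=> PNP indep.
have L2phi (j : 'I_N) : L2 (phi j) by exact: eigen_L2.
have L2u j : L2 (u 0%N j) by exact: iod_L2.
have PNu j := (PNP _ (L2u j)).1.
have /choice[M0 PM] j := (PNu j).2.
pose M := \matrix_(j, k) M0 j k.
have PMu j : aeq (PN (u 0%N j)) (\sum_k M j k *: phi k).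
  by under [X in Defs.aeq _ _ X]eq_bigr do rewrite mxE.
have L2PN j : L2 (PN (u 0%N j)) by have [] := PNu j.
have uphi j (k : 'I_N) : L2dot (u 0%N j) (phi k) = M j k * L2dot (phi k) (phi k).
  have /(_ _ (L2span_mem oOm k L2phi)) := (PNP _ (L2u j)).2.
  rewrite (herm_Bl dotH)// => /subr0_eq ->.
  rewrite (aeq_L2dot_suml oOm _ _ _ (PMu j))// (bigD1 k)//= big1 ?addr0// => l lk.
  by rewrite (eigen_orth phi_eig) ?mulr0.
(* A left null vector of [M] would be a linear relation among the projections of the initial
   functions. Multiplying those functions by the inverse of [M] turns their leading coordinates into
   the identity matrix. *)
have Mu : M \in unitmx.
  rewrite -row_free_unit -kermx_eq0; apply/rowV0P => r /sub_kermxP rM.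
  apply/rowP => j; rewrite mxE; apply: (indep (fun j => r 0 j)).
  apply: aeq_trans (aeq_sum _ PMu) _; rewrite sum_mulmx rM.
  by under eq_bigr do rewrite mxE scale0r; rewrite big1//; exact: aeq_refl.
exists (fun i => \sum_j invmx M i j *: u 0%N j); split=> [i|i|i k].
- by apply: (herm_dom_sum aH) => j; exact: iod_V.
- exact: L2span_sum.
- rewrite (herm_suml dotH)//; under eq_bigr do rewrite uphi mulrA.
  rewrite -mulr_suml; congr (_ * _).
  by have /matrixP/(_ i k) := mulVmx Mu; rewrite !mxE.
Qed.

Lemma iod_cvg (PN : fn -> fn) : (0 < N)%N ->
  orth_projector Om (L2span Om (fun j : 'I_N => phi j)) PN ->
  lin_indep Om (fun j => PN (u 0%N j)) -> lam N < lam N.-1 ->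
  spaces_cvg Om N (iod_space Om V u C) (L2span Om (fun j : 'I_N => phi j)).
Proof.
move=> N0 PNP indep gap.
have [v [Vv vu vphi]] := eigen_adapted_basis PNP indep.
(* Indices start at 0: [lam N.-1] is $\lambda_N$ and [lam N] is $\lambda_{N+1}$. *)
have lamN (j : 'I_N) : lam N < lam j.
  apply: lt_le_trans gap _; apply: (eigen_noninc phi_eig).
  by rewrite -ltnS prednK.
have lam0 (j : 'I_N) : 0 < lam j := le_lt_trans (eigen_ge0 phi_eig N) (lamN j).
pose step (j : 'I_N) (f : fn) : fn := ((lam j)^-1)%:C%C *: Linv f.
pose uh n (j : 'I_N) : fn := iter n (step j) (v j).
have Vuh n (j : 'I_N) : V (uh n j).
  elim: n => [|n IHn]; first exact: Vv.
  by apply: (herm_domZ aH); exact/Linv_V/V_L2.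
have L2uh n (j : 'I_N) : L2 (uh n j) by exact: V_L2.
have uhspan n (j : 'I_N) : L2span Om (u n) (uh n j).
  elim: n => [|n IHn]; first exact: vu.
  by apply: (L2span_scale oOm); exact: Linv_iod_span.
(* The factor $1/\lambda_j$ in [step] cancels the eigenvalue, so the pairings with the first [N]
   eigenfunctions never change. This makes [uh n] a basis for each [n] and keeps the error
   orthogonal to those eigenfunctions. *)
have uhphi n (j k : 'I_N) :
    L2dot (uh n j) (phi k) = (j == k)%:R * L2dot (phi k) (phi k).
  elim: n => [|n IHn]; first exact: vphi.
  rewrite /uh iterS -/(uh n j) /step (herm_Zl dotH)//; [|exact/V_L2/Linv_V|exact: eigen_L2].
  rewrite Linv_dot_eigen// IHn; have [<-|_] := eqVneq j k; last by rewrite !(mul0r, mulr0).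
  by rewrite /= mul1r mulrA -rmorphM/= mulVf ?gt_eqF// mul1r.
have phi_orth (j k : 'I_N) :
    L2dot (phi j) (phi k) = (j == k)%:R * L2dot (phi k) (phi k).
  have [->|jk] := eqVneq j k; first by rewrite mul1r.
  by rewrite (eigen_orth phi_eig) ?mul0r.
have L2phi (j : 'I_N) : L2 (phi j) := eigen_L2 j.
have phi_neq0 (j : 'I_N) := eigen_dot_neq0 j.
exists uh, (fun j : 'I_N => phi j); split=> //.
- move=> n; split=> //; first exact: (biorth_lin_indep oOm _ _ _ (uhphi n)).
  rewrite iod_spaceE; apply/esym; apply: (biorth_L2spanE oOm _ _ _ (uhphi n)) => // j.
  exact: iod_L2.
- move=> j; split=> //.
  (* Since [phi j] is fixed by [step j] up to [aeq], the error itself evolves by [step j], and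
     [Linv_contract] shrinks it by $\lambda_{N+1}/\lambda_j<1$ each time. *)
  have uh_le n : L2norm (uh n j - phi j) <= (lam N / lam j) ^+ n * L2norm (uh 0%N j - phi j).
    elim: n => [|n IHn]; first by rewrite expr0 mul1r.
    pose r := uh n j - phi j.
    have Vr : V r by apply: (herm_domB aH) => //; exact: eigen_V.
    have L2r := V_L2 Vr.
    have rphi i : (i < N)%N -> L2dot r (phi i) = 0.
      move=> iN; have L2i := eigen_L2 i; rewrite (herm_Bl dotH)//.
      by rewrite (uhphi n j (Ordinal iN)) (phi_orth j (Ordinal iN)) subrr.
    have uhr : aeq (uh n.+1 j - phi j) (((lam j)^-1)%:C%C *: Linv r).
      have Linvr : aeq (Linv r) (Linv (uh n j) - (lam j)%:C%C *: phi j).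
        apply: aeq_trans (LinvB (L2uh n j) (L2phi j)) _.
        rewrite ![Linv (uh n j) - _]addrC -![- (_ : fn)]scaleN1r.
        exact: aeq_lin (eigen_eq phi_eig j) (aeq_refl _).
      have := aeq_lin ((lam j)^-1)%:C%C Linvr (aeq_refl 0).
      rewrite !addr0 scalerBr scalerA -rmorphM/= mulVf ?gt_eqF// scale1r.
      exact: aeq_sym.
    rewrite (aeq_L2norm oOm _ _ uhr); first 1 last.
    + exact: (herm_domB dotH).
    + by apply: (herm_domZ dotH); exact/V_L2/Linv_V.
    rewrite (L2norm_scale oOm); last exact/V_L2/Linv_V.
    rewrite (ger0_norm (ltW _)) ?invr_gt0// exprS -mulrA.
    apply: (@le_trans _ _ ((lam j)^-1 * (lam N * L2norm r))).
      by rewrite ler_pM2l ?invr_gt0// Linv_contract.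
    rewrite mulrCA mulrA; apply: ler_wpM2l => //.
    by apply: divr_ge0; [exact: (eigen_ge0 phi_eig)|exact: ltW].
  have cvg0 : (lam N / lam j) ^+ n * L2norm (uh 0%N j - phi j) @[n --> \oo] --> (0 : R).
    rewrite -(mul0r (L2norm (uh 0%N j - phi j))); apply: cvgMr_tmp; apply: cvg_expr.
    rewrite ger0_norm; first by rewrite ltr_pdivrMr ?mul1r.
    by apply: divr_ge0; [exact: (eigen_ge0 phi_eig)|exact: ltW].
  apply: (squeeze_cvgr _ (cvg_cst 0) cvg0).
  by near=> n; rewrite L2norm_ge0 uh_le.
- exact: (biorth_lin_indep oOm _ _ _ phi_orth).
Unshelve. all: by end_near.
Qed.

End solution_operator.

Theorem theorem2p1 (R : realType) (d : nat) (Om : set 'rV[R]_d)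
  (m : nat) (V : set ('rV[R]_d -> R[i]))
  (a : ('rV[R]_d -> R[i]) -> ('rV[R]_d -> R[i]) -> R[i])
  (Linv : ('rV[R]_d -> R[i]) -> ('rV[R]_d -> R[i]))
  (lam : nat -> R) (phi : nat -> ('rV[R]_d -> R[i]))
  (P : nat -> ('rV[R]_d -> R[i]) -> ('rV[R]_d -> R[i]))
  (N : nat) (u : nat -> 'I_N -> ('rV[R]_d -> R[i]))
  (C : nat -> ('rV[R]_d -> R[i]) -> ('rV[R]_d -> R[i]))
  (d_gt0 : (0 < d)%N) (m_gt0 : (0 < m)%N) (N_gt0 : (0 < N)%N)
  (Om_dom : polyhedral_lipschitz_domain Om)
  (V_sob : sobolev_space Om m V)
  (V_cpt : compactly_embedded Om m V)
  (a_form : bounded_hermitian_form Om m V a)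
  (a_pos : positive_definite Om V a)
  (L_wp : well_posed Om m V a Linv)
  (phi_eig : eigensystem Om m V Linv lam phi)
  (P_proj : forall i : nat, (0 < i)%N ->
     orth_projector Om (L2span Om (fun j : 'I_i => phi j)) (P i))
  (u_iod : iod Om V a u C)
  (rank_cond : forall (i : nat) (le_iN : (i <= N)%N), (0 < i)%N ->
     lin_indep Om (fun j : 'I_i => P i (u 0%N (widen_ord le_iN j))))
  (gap : lam N < lam N.-1) :
  spaces_cvg Om N (iod_space Om V u C) (L2span Om (fun j : 'I_N => phi j)).
Proof.
apply: (iod_cvg (domain_open Om_dom) V_sob a_form a_pos L_wp phi_eig u_iod N_gt0
  (P_proj N N_gt0) _ gap).
(* At $i=N$ the map [widen_ord] preserves values, so it is the identity by [val_inj]. *)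
have := rank_cond N (leqnn N) N_gt0.
by congr lin_indep; apply/funext => j; congr (P N (u _ _)); exact: val_inj.
Qed.
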